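(* Let $g:\mathbb{R}^n\times\mathbb{R}\to\mathbb{R}$ be defined by $$g(z,\varphi)=\frac{\lambda}{2}\big(a^\top z+b-\varphi\big)^2+\gamma|\varphi|$$ with $a\in\mathbb{R}^n\setminus\{0\}$, $b\in\mathbb{R}$, $\lambda>0$ and $\gamma>0$. Then the pair of functions $x\mapsto z_g^*(x)$, $x\mapsto\varphi_g^*(x)$ defined by $$\big(z_g^*(x),\varphi_g^*(x)\big)=\operatorname*{arg\,min}_{(z,\varphi)\in\mathbb{R}^n\times\mathbb{R}}\Big[\tfrac12\|z-x\|_2^2+g(z,\varphi)\Big]$$ is well-defined on $\mathbb{R}^n$ (i.e., the minimizer exists and is unique for every $x\in\mathbb{R}^n$) and is given by $$z_g^*(x)=x-\gamma\,\mathrm{Sat}_1(\rho(x))\,a,\qquad \varphi_g^*(x)=\eta\,\mathrm{Dz}_1(\rho(x)),$$ where $$\rho(x)=\frac{a^\top x+b}{\eta},\qquad \eta=\gamma\Big(\frac1\lambda+\|a\|_2^2\Big).$$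
   Context: $\mathrm{Sat}_1:\mathbb{R}\to\mathbb{R}$ is the saturation function: $\mathrm{Sat}_1(e)=\mathrm{sign}(e)$ if $|e|>1$ and $\mathrm{Sat}_1(e)=e$ if $|e|\le1$. $\mathrm{Dz}_1$ is the deadzone function $\mathrm{Dz}_1(e)=e-\mathrm{Sat}_1(e)$. $\|\cdot\|_2$ is the Euclidean norm. *)

(* Defs.v *)
From mathcomp Require Import all_boot all_order all_algebra.
From mathcomp Require Import reals.

Set Implicit Arguments.
Unset Strict Implicit.
Unset Printing Implicit Defensive.

Import Order.TTheory GRing.Theory Num.Theory.
Local Open Scope ring_scope.

Definition Sat1 {R : realType} (e : R) : R :=
  if 1 < `|e| then Num.sg e else e.

Definition Dz1 {R : realType} (e : R) : R := e - Sat1 e.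

(* The library norm `|x| on matrices is the sup norm, hence this definition. *)
Definition norm2 {R : realType} {n : nat} (x : 'cV[R]_n) : R :=
  Num.sqrt (\sum_(i < n) x i 0 ^+ 2).

Definition dot {R : realType} {n : nat} (a z : 'cV[R]_n) : R :=
  (a^T *m z) 0 0.

Definition is_argmin {R : realType} {T : Type} (F : T -> R) (p : T) : Prop :=
  forall q : T, F p <= F q.

Definition prox_obj {R : realType} {n : nat} (g : 'cV[R]_n -> R -> R)
    (x : 'cV[R]_n) (p : 'cV[R]_n * R) : R :=
  2^-1 * norm2 (p.1 - x) ^+ 2 + g p.1 p.2.

(* Main.v *)
Require Import Defs.
From mathcomp Require Import all_boot all_order all_algebra.
From mathcomp Require Import reals.
From mathcomp Require Import ring lra.
Import Order.TTheory GRing.Theory Num.Theory.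
Local Open Scope ring_scope.

(** The objective is convex, and its first-order condition can be solved in
    closed form.  Let s = Sat1 (rho x), let (zs, phis) be the announced pair
    and let r = dot a z + b - phi be the residual of a pair (z, phi).  The
    choice of eta makes the residual at (zs, phis) equal to gamma * s / lambda,
    so that stationarity in z, which is zs - x + lambda * r * a = 0, holds,
    while stationarity in phi asks that s be a subgradient of the absolute
    value at phis = eta * Dz1 (rho x).  It is one, because |s| <= 1 and the
    deadzone vanishes unless s is its sign ([Sat1_norm_le1], [normr_Dz1]).

    As everything but the absolute value is quadratic, completing the squares
    turns stationarity into an exact formula ([prox_obj_gap]): the objective at
    (z, phi) exceeds its value at (zs, phis) by half the squared distance from
    z to zs, plus lambda / 2 times the squared difference of the residuals,
    plus gamma * (|phi| - s * phi).  The three terms are nonnegative, so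
    (zs, phis) is a minimizer; if they all vanish then z = zs, and equality of
    the residuals gives phi = phis, so it is the only one. *)

Lemma dotC {R : realType} {n : nat} (u v : 'cV[R]_n) : dot u v = dot v u.
Proof. by rewrite /dot -[in LHS](trmxK v) -trmx_mul mxE. Qed.

Lemma dotDr {R : realType} {n : nat} (u v w : 'cV[R]_n) :
  dot u (v + w) = dot u v + dot u w.
Proof. by rewrite /dot mulmxDr mxE. Qed.

Lemma dotZr {R : realType} {n : nat} (k : R) (u v : 'cV[R]_n) :
  dot u (k *: v) = k * dot u v.
Proof. by rewrite /dot -scalemxAr mxE. Qed.

Lemma norm2_sqr {R : realType} {n : nat} (u : 'cV[R]_n) :
  norm2 u ^+ 2 = dot u u.
Proof.
rewrite /norm2 sqr_sqrtr; last by apply: sumr_ge0 => i _; exact: sqr_ge0.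
by rewrite /dot mxE; apply: eq_bigr => i _; rewrite mxE expr2.
Qed.

Lemma norm2_eq0 {R : realType} {n : nat} (u : 'cV[R]_n) :
  norm2 u ^+ 2 = 0 -> u = 0.
Proof.
rewrite norm2_sqr /dot mxE => u0.
have ge0 (i : 'I_n) : true -> 0 <= u^T 0 i * u i 0.
  by move=> _; rewrite mxE -expr2 sqr_ge0.
apply/colP => i; rewrite mxE.
have /eqP : u^T 0 i * u i 0 = 0 by exact: (psumr_eq0P ge0 u0).
by rewrite mxE mulf_eq0 orbb => /eqP.
Qed.

Lemma norm2_sqrDZ {R : realType} {n : nat} (k : R) (u v : 'cV[R]_n) :
  norm2 (u + k *: v) ^+ 2 =
  norm2 u ^+ 2 + 2 * k * dot v u + k ^+ 2 * norm2 v ^+ 2.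
Proof.
rewrite !norm2_sqr dotDr dotZr (dotC _ u) (dotC _ v) !dotDr !dotZr (dotC u v).
by ring.
Qed.

Lemma Sat1_norm_le1 {R : realType} (e : R) : `|Sat1 e| <= 1.
Proof.
by rewrite /Sat1; case: ltP => // _; rewrite normr_sg lern1 leq_b1.
Qed.

Lemma normr_Dz1 {R : realType} (e : R) : `|Dz1 e| = Sat1 e * Dz1 e.
Proof.
rewrite /Dz1 /Sat1; case: ltP => [e_gt1 | _]; last by rewrite subrr normr0 mulr0.
have [e_ge0 | e_lt0] := lerP 0 e.
  rewrite ger0_norm // in e_gt1.
  by rewrite gtr0_sg ?(lt_trans ltr01) // mul1r ger0_norm // subr_ge0 ltW.
rewrite ltr0_norm // in e_gt1.
by rewrite ltr0_sg // mulN1r ler0_norm //; lra.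
Qed.

Lemma ler_subgrad_normr {R : realType} (s t : R) : `|s| <= 1 -> s * t <= `|t|.
Proof.
move=> s_le1; apply: le_trans (ler_norm _) _.
by rewrite normrM ler_piMl.
Qed.

Definition affine_abs_penalty {R : realType} {n : nat} (a : 'cV[R]_n)
    (b lambda gamma : R) (z : 'cV[R]_n) (phi : R) : R :=
  lambda / 2 * (dot a z + b - phi) ^+ 2 + gamma * `|phi|.

(** The residual hypothesis makes zs stationary in z, and the other one makes
    t |-> s * t touch the absolute value at phis.  Hence the first-order terms
    of the expansion around (zs, phis) add up to the excess of the absolute
    value over that line, which is the last term. *)
Lemma prox_obj_gap {R : realType} {n : nat} (a x z : 'cV[R]_n)
    (b lambda gamma s phi phis : R) :
  let zs := x - (gamma * s) *: a in
  let F := prox_obj (affine_abs_penalty a b lambda gamma) x in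
  lambda * (dot a zs + b - phis) = gamma * s ->
  `|phis| = s * phis ->
  F (z, phi) = F (zs, phis) + (2^-1 * norm2 (z - zs) ^+ 2
    + lambda / 2 * (dot a (z - zs) - (phi - phis)) ^+ 2
    + gamma * (`|phi| - s * phi)).
Proof.
move=> zs F res_s abs_s.
have zE : z = zs + (z - zs) by rewrite addrC subrK.
rewrite {1}zE; move: (z - zs) => d.
rewrite /F /prox_obj /affine_abs_penalty /= abs_s.
have -> : zs + d - x = d + (- (gamma * s)) *: a.
  by rewrite /zs scaleNr addrC !addrA addNr add0r addrC.
have -> : zs - x = 0 + (- (gamma * s)) *: a.
  by rewrite /zs scaleNr add0r addrAC subrr add0r.
have norm0 : norm2 (0 : 'cV[R]_n) ^+ 2 = 0 by rewrite norm2_sqr /dot mulmx0 mxE.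
have dot0 : dot a 0 = 0 by rewrite /dot mulmx0 mxE.
rewrite !norm2_sqrDZ norm0 dot0 dotDr.
(* The expansion of the squared residual has the cross term
   lambda * r * (dot a d - (phi - phis)); stationarity turns its coefficient
   into gamma * s, and its part in d cancels that of the squared norm. *)
set r := dot a zs + b - phis in res_s *.
have -> : dot a zs + dot a d + b - phi = r + (dot a d - (phi - phis)).
  by rewrite /r; ring.
have -> : lambda / 2 * (r + (dot a d - (phi - phis))) ^+ 2 =
    lambda / 2 * r ^+ 2 + gamma * s * (dot a d - (phi - phis))
    + lambda / 2 * (dot a d - (phi - phis)) ^+ 2.
  by rewrite -res_s; field.
by field.
Qed.

(** The first half is existence of a minimizer.  The second is uniqueness and
    the closed form at once, since every minimizer q satisfies F q <= F p. *)
Lemma prox_obj_unique_min {R : realType} {n : nat} (a x : 'cV[R]_n)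
    (b lambda gamma : R) (hlambda : 0 < lambda) (hgamma : 0 < gamma) :
  let eta := gamma * (lambda^-1 + norm2 a ^+ 2) in
  let rho := (dot a x + b) / eta in
  let p := (x - (gamma * Sat1 rho) *: a, eta * Dz1 rho) in
  let F := prox_obj (affine_abs_penalty a b lambda gamma) x in
  forall q, F p <= F q /\ (F q <= F p -> q = p).
Proof.
move=> eta rho p F [z phi].
have eta_gt0 : 0 < eta.
  by rewrite mulr_gt0 // ltr_wpDr ?sqr_ge0 // invr_gt0.
have res_s : lambda * (dot a p.1 + b - p.2) = gamma * Sat1 rho.
  have axE : dot a x = eta * rho - b.
    by rewrite /rho mulrC divfK ?gt_eqF // addrK.
  rewrite /p /= -scaleNr dotDr dotZr -norm2_sqr axE /Dz1 /eta.
  by field; rewrite gt_eqF.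
have abs_s : `|p.2| = Sat1 rho * p.2.
  by rewrite /p /= normrM normr_Dz1 gtr0_norm // mulrCA.
have gap := prox_obj_gap a x z b lambda gamma (Sat1 rho) phi p.2 res_s abs_s.
rewrite -/F in gap.
set d := z - _ in gap.
set A := 2^-1 * _ in gap.
set B := lambda / 2 * _ in gap.
set C := gamma * (_ - _) in gap.
have A_ge0 : 0 <= A by rewrite mulr_ge0 ?sqr_ge0 // invr_ge0.
have B_ge0 : 0 <= B by rewrite mulr_ge0 ?sqr_ge0 // divr_ge0 // ltW.
have C_ge0 : 0 <= C.
  apply: mulr_ge0; [exact: ltW | rewrite subr_ge0].
  exact/ler_subgrad_normr/Sat1_norm_le1.
rewrite gap; split; first by rewrite lerDl !addr_ge0.
rewrite gerDl => gap_le0.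
have /eqP A0 : A == 0 by lra.
have /eqP B0 : B == 0 by lra.
have d0 : d = 0.
  by apply: norm2_eq0; apply/eqP; move/eqP: A0; rewrite mulf_eq0 invr_eq0 pnatr_eq0.
have phi_p : phi = p.2.
  move/eqP: B0; rewrite mulf_eq0 gt_eqF ?divr_gt0 //= sqrf_eq0 d0.
  by rewrite /dot mulmx0 mxE sub0r oppr_eq0 subr_eq0 => /eqP.
by rewrite phi_p; congr pair; apply/eqP; rewrite -subr_eq0 -/d d0.
Qed.

Theorem lemma11 (R : realType) (n : nat) (a : 'cV[R]_n) (b lambda gamma : R)
    (ha : a != 0) (hlambda : 0 < lambda) (hgamma : 0 < gamma) :
  let g := fun (z : 'cV[R]_n) (phi : R) =>
    lambda / 2 * (dot a z + b - phi) ^+ 2 + gamma * `|phi| in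
  let eta := gamma * (lambda^-1 + norm2 a ^+ 2) in
  let rho := fun x : 'cV[R]_n => (dot a x + b) / eta in
  (forall x : 'cV[R]_n,
     exists! p : 'cV[R]_n * R, is_argmin (prox_obj g x) p) /\
  (forall (zg : 'cV[R]_n -> 'cV[R]_n) (phig : 'cV[R]_n -> R),
     (forall x : 'cV[R]_n, is_argmin (prox_obj g x) (zg x, phig x)) ->
     forall x : 'cV[R]_n,
       zg x = x - (gamma * Sat1 (rho x)) *: a /\
       phig x = eta * Dz1 (rho x)).
Proof.
move=> g eta rho.
have min_p x := prox_obj_unique_min a x b lambda gamma hlambda hgamma.
split=> [x | zg phig zg_min x].
  eexists; split=> [q | q q_min]; first exact: (min_p x q).1.
  by symmetry; apply: (min_p x q).2; exact: q_min.
by case: ((min_p x (zg x, phig x)).2 (zg_min x _)).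
Qed.
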